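(* Let $T=(R,V,W,S)=\begin{pmatrix} R & V\\ W & S\end{pmatrix}$ be a Morita context and let $(I,V_1,W_1,J)=\begin{pmatrix} I & V_1\\ W_1 & J\end{pmatrix}$ be an ideal of $T$. Then the following are equivalent. (1) $(I,V_1,W_1,J)$ is a semiprime ideal of $T$. (2) $I$ and $J$ are semiprime ideals of $R$ and $S$, respectively, and $V_1=\{v\in V : vW\subseteq I\}=\{v\in V : Wv\subseteq J\}$ and $W_1=\{w\in W : Vw\subseteq I\}=\{w\in W : wV\subseteq J\}$.
   Context: All rings are associative with $1\neq 0$ and all modules are unitary. A Morita context is a 4-tuple $(R,V,W,S)$, where $R,S$ are rings, ${}_RV_S$ and ${}_SW_R$ are bimodules, with context products $V\times W\to R$, $(v,w)\mapsto vw$, and $W\times V\to S$, $(w,v)\mapsto wv$, such that $\begin{pmatrix} R & V\\ W & S\end{pmatrix}$ is an associative ring under the usual matrix operations; this ring is also denoted $(R,V,W,S)$. For subsets $I\subseteq R$, $V_1\subseteq V$, $W_1\subseteq W$, $J\subseteq S$, $(I,V_1,W_1,J)=\begin{pmatrix} I & V_1\\ W_1 & J\end{pmatrix}$ denotes the set of all matrices $\begin{pmatrix} r & v\\ w & s\end{pmatrix}$ with $r\in I$, $v\in V_1$, $w\in W_1$, $s\in J$. Ideals are two-sided. $vW=\{vw: w\in W\}$, and similarly for $Wv$, $Vw$, $wV$. A proper ideal $P$ of a ring $A$ is semiprime if for all $a\in A$, $aAa\subseteq P$ implies $a\in P$.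
   Formalization: With ''proper'' in ''semiprime'', (1)⇒(2) fails if exactly one of I=R, J=S holds (V=W=0, ideal R×J); the equivalence is stated when I=R iff J=S, and for all ideals with ''semiprime'' read as ''semiprime or the whole ring''. *)

(* Defs.v *)
From HB Require Import structures.
From mathcomp Require Import all_boot all_order all_algebra.
From mathcomp Require Import boolp classical_sets.

Set Implicit Arguments.
Unset Strict Implicit.
Unset Printing Implicit Defensive.

Import GRing.Theory.
Local Open Scope ring_scope.
Local Open Scope classical_set_scope.

HB.mixin Record Lmodule_isBimodule (R S : nzRingType) V
    of GRing.Lmodule R V := {
  rscale : V -> S -> V;
  rscaleDl : forall s, {morph rscale^~ s : u v / u + v};
  rscaleDr : forall v, {morph rscale v : s t / s + t};
  rscaleA : forall v s t, rscale (rscale v s) t = rscale v (s * t);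
  rscaler1 : right_id 1 rscale;
  scale_rscaleA : forall (r : R) v s, r *: rscale v s = rscale (r *: v) s
}.

#[short(type="bimodType")]
HB.structure Definition Bimodule (R S : nzRingType) :=
  {V of Lmodule_isBimodule R S V & GRing.Lmodule R V}.

Notation "v :*r s" := (rscale v s)
  (at level 40, left associativity) : ring_scope.

Record mat2 (A B C D : Type) :=
  Mat2 { ul : A; ur : B; dl : C; dr : D }.

Section Mat2Zmodule.
Variables A B C D : zmodType.
Local Notation M := (mat2 A B C D).

Definition tuple_of_mat2 (x : M) : A * B * C * D := (ul x, ur x, dl x, dr x).
Definition mat2_of_tuple (t : A * B * C * D) : M :=
  let: (a, b, c, d) := t in Mat2 a b c d.

Lemma tuple_of_mat2K : cancel tuple_of_mat2 mat2_of_tuple.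
Proof. by case. Qed.

HB.instance Definition _ := Choice.copy M (can_type tuple_of_mat2K).

Definition mat2_add (x y : M) : M :=
  Mat2 (ul x + ul y) (ur x + ur y) (dl x + dl y) (dr x + dr y).
Definition mat2_opp (x : M) : M :=
  Mat2 (- ul x) (- ur x) (- dl x) (- dr x).

Fact mat2_addA : associative mat2_add.
Proof. by move=> x y z; rewrite /mat2_add /= !addrA. Qed.
Fact mat2_addC : commutative mat2_add.
Proof.
move=> x y; rewrite /mat2_add.
by congr Mat2; rewrite addrC.
Qed.
Fact mat2_add0 : left_id (Mat2 0 0 0 0) mat2_add.
Proof. by case=> a b c d; rewrite /mat2_add /= !add0r. Qed.
Fact mat2_addN : left_inverse (Mat2 0 0 0 0) mat2_opp mat2_add.
Proof. by move=> x; rewrite /mat2_add /= !addNr. Qed.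

HB.instance Definition _ :=
  GRing.isZmodule.Build M mat2_addA mat2_addC mat2_add0 mat2_addN.
End Mat2Zmodule.

Definition mat2_mul (R S : nzRingType) (V : bimodType R S) (W : bimodType S R)
    (vw : V -> W -> R) (wv : W -> V -> S) (x y : mat2 R V W S) : mat2 R V W S :=
  Mat2 (ul x * ul y + vw (ur x) (dl y)) (ul x *: ur y + ur x :*r dr y)
       (dl x :*r ul y + dr x *: dl y)    (wv (dl x) (ur y) + dr x * dr y).

(* The existence of a unit is not required here: the identity matrix is
   automatically one, because the bimodules are unitary. *)
Record moritaContext (R S : nzRingType)
    (V : bimodType R S) (W : bimodType S R) := MoritaContext {
  mc_vw : V -> W -> R;
  mc_wv : W -> V -> S;
  mc_mulA : associative (mat2_mul mc_vw mc_wv);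
  mc_mulDl : left_distributive (mat2_mul mc_vw mc_wv) +%R;
  mc_mulDr : right_distributive (mat2_mul mc_vw mc_wv) +%R
}.

(* The alias carries the context, so that its ring structure can be inferred. *)
Definition mc_ring (R S : nzRingType) (V : bimodType R S) (W : bimodType S R)
  (T : moritaContext V W) : Type := mat2 R V W S.

Section MoritaRing.
Variables (R S : nzRingType) (V : bimodType R S) (W : bimodType S R).
Variable T : moritaContext V W.

HB.instance Definition _ := GRing.Zmodule.on (mc_ring T).

Let mul : mc_ring T -> mc_ring T -> mc_ring T :=
  mat2_mul (mc_vw T) (mc_wv T).
Let one : mc_ring T := Mat2 1 0 0 1.

Fact rscale0r (R' S' : nzRingType) (U : bimodType R' S') (s : S') :
  (0 : U) :*r s = 0.
Proof. by apply: (addrI (0 :*r s)); rewrite -rscaleDl !addr0. Qed.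

Fact rscaler0 (R' S' : nzRingType) (U : bimodType R' S') (u : U) :
  u :*r (0 : S') = 0.
Proof. by apply: (addrI (u :*r 0)); rewrite -rscaleDr !addr0. Qed.

Fact mc_mul0 (x : mc_ring T) : mul 0 x = 0.
Proof. by apply: (addrI (mul 0 x)); rewrite -[LHS]mc_mulDl !addr0. Qed.

Fact mc_mulr0 (x : mc_ring T) : mul x 0 = 0.
Proof. by apply: (addrI (mul x 0)); rewrite -[LHS]mc_mulDr !addr0. Qed.

Fact mc_vw0 (w : W) : mc_vw T 0 w = 0.
Proof.
have := congr1 (@ul _ _ _ _) (mc_mul0 (Mat2 0 0 w 0)).
by rewrite /= mulr0 add0r.
Qed.

Fact mc_vwr0 (v : V) : mc_vw T v 0 = 0.
Proof.
have := congr1 (@ul _ _ _ _) (mc_mulr0 (Mat2 0 v 0 0)).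
by rewrite /= mulr0 add0r.
Qed.

Fact mc_wv0 (v : V) : mc_wv T 0 v = 0.
Proof.
have := congr1 (@dr _ _ _ _) (mc_mul0 (Mat2 0 v 0 0)).
by rewrite /= mulr0 addr0.
Qed.

Fact mc_wvr0 (w : W) : mc_wv T w 0 = 0.
Proof.
have := congr1 (@dr _ _ _ _) (mc_mulr0 (Mat2 0 0 w 0)).
by rewrite /= mulr0 addr0.
Qed.

Fact mc_mul1 : left_id one mul.
Proof.
case=> a v w b; rewrite /mul /mat2_mul /= !mul1r !scale1r.
by rewrite mc_vw0 mc_wv0 !rscale0r !addr0 !add0r.
Qed.

Fact mc_mulr1 : right_id one mul.
Proof.
case=> a v w b; rewrite /mul /mat2_mul /= !mulr1 !rscaler1 !scaler0.
by rewrite mc_vwr0 mc_wvr0 !addr0 !add0r.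
Qed.

Fact mc_one_neq0 : one != 0.
Proof.
by apply/eqP => /(congr1 (@ul _ _ _ _)) /= /eqP; rewrite oner_eq0.
Qed.

HB.instance Definition _ := GRing.Zmodule_isNzRing.Build (mc_ring T)
  (mc_mulA T) mc_mul1 mc_mulr1 (mc_mulDl T) (mc_mulDr T) mc_one_neq0.

Definition mc_set (I : set R) (V1 : set V) (W1 : set W) (J : set S) :
    set (mc_ring T) :=
  [set x : mc_ring T | [/\ I (ul x), V1 (ur x), W1 (dl x) & J (dr x)]].
End MoritaRing.
Arguments mc_set {R S V W} T I V1 W1 J _.

Record two_sided_ideal (A : nzRingType) (P : set A) : Prop := TwoSidedIdeal {
  tsideal0 : P 0;
  tsidealB : forall x y, P x -> P y -> P (x - y);
  tsidealMl : forall a x, P x -> P (a * x);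
  tsidealMr : forall a x, P x -> P (x * a)
}.

Definition semiprime_ideal (A : nzRingType) (P : set A) : Prop :=
  [/\ two_sided_ideal P, P <> setT &
      forall a : A, range (fun x => a * x * a) `<=` P -> P a].

(* Properness cannot be kept everywhere when passing between a Morita context
   ring and its diagonal: if V = W = 0, the ideal (R, 0, 0, J) is semiprime
   whenever J is, but its component R is not proper. *)
Definition semiprime_or_improper (A : nzRingType) (P : set A) : Prop :=
  semiprime_ideal P \/ P = setT.

(* Main.v *)
(** An element a of R lies in I as soon as the matrix (a,0,0,0) lies in the
    ideal, and likewise for the other three corners; sandwiching a one-corner
    matrix between elements of T only uses the corresponding corner, which gives
    (1) => (2).  Conversely, if A = (r,v,w,s) satisfies A T A <= P, the diagonal
    corners of A (x,0,0,0) A and A (0,0,0,y) A put r in I and s in J.  The upper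
    right corner of A (0,0,w'x,0) A is (vw')xv, which is in V1, so
    (vw')x(vw') is in I for all x; semiprimeness of I gives vW <= I, that is,
    v in V1, and w is handled in the same way. *)
Require Import Defs.
From HB Require Import structures.
From mathcomp Require Import all_boot all_order all_algebra.
From mathcomp Require Import boolp classical_sets.

Set Implicit Arguments.
Unset Strict Implicit.

Import GRing.Theory.
Local Open Scope ring_scope.
Local Open Scope classical_set_scope.

(** Semiprimeness with properness split off. This part transfers between the context ring and its
    corners without restriction, so properness is treated separately. *)
Definition absorbs_sandwich (A : nzRingType) (Q : set A) : Prop :=
  forall a : A, range (fun x => a * x * a) `<=` Q -> Q a.

Section IdealComponents.
Variables (R S : nzRingType) (V : bimodType R S) (W : bimodType S R).
Variable T : moritaContext V W.

Local Notation vw := (mc_vw T).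
Local Notation wv := (mc_wv T).

Lemma mc_mulE a v w b a' v' w' b' :
  (Mat2 a v w b : mc_ring T) * (Mat2 a' v' w' b' : mc_ring T) =
  Mat2 (a * a' + vw v w') (a *: v' + v :*r b')
       (w :*r a' + b *: w') (wv w v' + b * b').
Proof. by []. Qed.

Let simp0 := (mulr0, mul0r, scaler0, scale0r, rscale0r, rscaler0,
  mc_vw0, mc_vwr0, mc_wv0, mc_wvr0, addr0, add0r).

(** The context axioms speak only of matrices. This and the next four compatibility laws are read
    off one corner of the associativity of three one-corner matrices. *)
Lemma mc_vw_rscalel v s w : vw (v :*r s) w = vw v (s *: w).
Proof.
have := mulrA (Mat2 0 v 0 0 : mc_ring T) (Mat2 0 0 0 s) (Mat2 0 0 w 0).
by rewrite !mc_mulE !simp0 => -[].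
Qed.

Lemma mc_vw_scalel r v w : vw (r *: v) w = r * vw v w.
Proof.
have := mulrA (Mat2 r 0 0 0 : mc_ring T) (Mat2 0 v 0 0) (Mat2 0 0 w 0).
by rewrite !mc_mulE !simp0 => -[].
Qed.

Lemma mc_vw_rscaler v w r : vw v (w :*r r) = vw v w * r.
Proof.
have := mulrA (Mat2 0 v 0 0 : mc_ring T) (Mat2 0 0 w 0) (Mat2 r 0 0 0).
by rewrite !mc_mulE !simp0 => -[].
Qed.

Lemma mc_rscale_wv v w v' : v :*r wv w v' = vw v w *: v'.
Proof.
have := mulrA (Mat2 0 v 0 0 : mc_ring T) (Mat2 0 0 w 0) (Mat2 0 v' 0 0).
by rewrite !mc_mulE !simp0 => -[].
Qed.

Lemma mc_rscale_vw w v w' : w :*r vw v w' = wv w v *: w'.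
Proof.
have := mulrA (Mat2 0 0 w 0 : mc_ring T) (Mat2 0 v 0 0) (Mat2 0 0 w' 0).
by rewrite !mc_mulE !simp0 => -[].
Qed.

Variables (I : set R) (V1 : set V) (W1 : set W) (J : set S).
Local Notation P := (mc_set T I V1 W1 J).
Hypothesis idealP : two_sided_ideal P.

(** The zero matrix lies in [P], so each of the four sets contains 0 and the zero entries of a
    one-corner matrix impose no condition. *)
Lemma mc_ideal_ulP a : P (Mat2 a 0 0 0) <-> I a.
Proof. by case: (tsideal0 idealP) => ? ? ? ?; split=> [[]|]. Qed.

Lemma mc_ideal_urP v : P (Mat2 0 v 0 0) <-> V1 v.
Proof. by case: (tsideal0 idealP) => ? ? ? ?; split=> [[]|]. Qed.

Lemma mc_ideal_dlP w : P (Mat2 0 0 w 0) <-> W1 w.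
Proof. by case: (tsideal0 idealP) => ? ? ? ?; split=> [[]|]. Qed.

Lemma mc_ideal_drP b : P (Mat2 0 0 0 b) <-> J b.
Proof. by case: (tsideal0 idealP) => ? ? ? ?; split=> [[]|]. Qed.

Lemma mc_ideal_ul : two_sided_ideal I.
Proof.
split.
- by case: (tsideal0 idealP).
- by move=> x y /mc_ideal_ulP Px /mc_ideal_ulP Py; case: (tsidealB idealP Px Py).
- move=> a x /mc_ideal_ulP /(tsidealMl idealP (Mat2 a 0 0 0)).
  by rewrite mc_mulE !simp0 => -[].
- move=> a x /mc_ideal_ulP /(tsidealMr idealP (Mat2 a 0 0 0)).
  by rewrite mc_mulE !simp0 => -[].
Qed.

Lemma mc_ideal_dr : two_sided_ideal J.
Proof.
split.
- by case: (tsideal0 idealP).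
- by move=> x y /mc_ideal_drP Px /mc_ideal_drP Py; case: (tsidealB idealP Px Py).
- move=> a x /mc_ideal_drP /(tsidealMl idealP (Mat2 0 0 0 a)).
  by rewrite mc_mulE !simp0 => -[].
- move=> a x /mc_ideal_drP /(tsidealMr idealP (Mat2 0 0 0 a)).
  by rewrite mc_mulE !simp0 => -[].
Qed.

(** Here and in the next lemmas, multiplying by a one-corner matrix on the suitable side moves an
    entry of the ideal into an adjacent corner. *)
Lemma mc_ideal_vwl v w : V1 v -> I (vw v w).
Proof.
move=> /mc_ideal_urP /(tsidealMr idealP (Mat2 0 0 w 0)).
by rewrite mc_mulE !simp0 => -[].
Qed.

Lemma mc_ideal_vwr v w : W1 w -> I (vw v w).
Proof.
move=> /mc_ideal_dlP /(tsidealMl idealP (Mat2 0 v 0 0)).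
by rewrite mc_mulE !simp0 => -[].
Qed.

Lemma mc_ideal_wvl w v : W1 w -> J (wv w v).
Proof.
move=> /mc_ideal_dlP /(tsidealMr idealP (Mat2 0 v 0 0)).
by rewrite mc_mulE !simp0 => -[].
Qed.

Lemma mc_ideal_wvr w v : V1 v -> J (wv w v).
Proof.
move=> /mc_ideal_urP /(tsidealMl idealP (Mat2 0 0 w 0)).
by rewrite mc_mulE !simp0 => -[].
Qed.

Lemma mc_ideal_scaleV a v : I a -> V1 (a *: v).
Proof.
move=> /mc_ideal_ulP /(tsidealMr idealP (Mat2 0 v 0 0)).
by rewrite mc_mulE !simp0 => -[].
Qed.

Lemma mc_ideal_rscaleV v b : J b -> V1 (v :*r b).
Proof.
move=> /mc_ideal_drP /(tsidealMl idealP (Mat2 0 v 0 0)).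
by rewrite mc_mulE !simp0 => -[].
Qed.

Lemma mc_ideal_scaleW b w : J b -> W1 (b *: w).
Proof.
move=> /mc_ideal_drP /(tsidealMr idealP (Mat2 0 0 w 0)).
by rewrite mc_mulE !simp0 => -[].
Qed.

Lemma mc_ideal_rscaleW w a : I a -> W1 (w :*r a).
Proof.
move=> /mc_ideal_ulP /(tsidealMl idealP (Mat2 0 0 w 0)).
by rewrite mc_mulE !simp0 => -[].
Qed.

Definition annihilator_corners : Prop :=
  [/\ V1 = [set v : V | [set vw v w | w in setT] `<=` I],
      V1 = [set v : V | [set wv w v | w in setT] `<=` J],
      W1 = [set w : W | [set vw v w | v in setT] `<=` I] &
      W1 = [set w : W | [set wv w v | v in setT] `<=` J]].

Lemma absorbs_sandwich_ul : absorbs_sandwich P -> absorbs_sandwich I.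
Proof.
move=> spP a aRa; apply/mc_ideal_ulP/spP => _ [[x v w y] _ <-].
rewrite !mc_mulE !simp0; apply/mc_ideal_ulP/aRa.
by exists x.
Qed.

Lemma absorbs_sandwich_dr : absorbs_sandwich P -> absorbs_sandwich J.
Proof.
move=> spP b bSb; apply/mc_ideal_drP/spP => _ [[x v w y] _ <-].
rewrite !mc_mulE !simp0; apply/mc_ideal_drP/bSb.
by exists y.
Qed.

(** One inclusion of each equality is ideal absorption. For the other, a sandwich by the matrix with
    single entry [v] leaves only the corner (vw)v = v(wv), which lies in [V1] once vw is in [I] or
    wv is in [J]; similarly for [W1]. *)
Lemma absorbs_sandwich_corners : absorbs_sandwich P -> annihilator_corners.
Proof.
move=> spP; split; apply/seteqP; split.
- by move=> v V1v _ [w _ <-]; exact: mc_ideal_vwl.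
- move=> v vWI; apply/mc_ideal_urP/spP => _ [[x v' w y] _ <-].
  rewrite !mc_mulE !simp0; apply/mc_ideal_urP/mc_ideal_scaleV/vWI.
  by exists w.
- by move=> v V1v _ [w _ <-]; exact: mc_ideal_wvr.
- move=> v WvJ; apply/mc_ideal_urP/spP => _ [[x v' w y] _ <-].
  (* The corner (vw)v is regrouped as v(wv) to expose a factor from [J]. *)
  rewrite !mc_mulE !simp0 -mc_rscale_wv.
  by apply/mc_ideal_urP/mc_ideal_rscaleV/WvJ; exists w.
- by move=> w W1w _ [v _ <-]; exact: mc_ideal_vwr.
- move=> w VwI; apply/mc_ideal_dlP/spP => _ [[x v w' y] _ <-].
  rewrite !mc_mulE !simp0 -mc_rscale_vw.
  by apply/mc_ideal_dlP/mc_ideal_rscaleW/VwI; exists v.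
- by move=> w W1w _ [v _ <-]; exact: mc_ideal_wvl.
- move=> w wVJ; apply/mc_ideal_dlP/spP => _ [[x v w' y] _ <-].
  rewrite !mc_mulE !simp0; apply/mc_ideal_dlP/mc_ideal_scaleW/wVJ.
  by exists v.
Qed.

Lemma absorbs_sandwich_mc :
  absorbs_sandwich I -> absorbs_sandwich J -> annihilator_corners ->
  absorbs_sandwich P.
Proof.
move=> spI spJ [V1E _ W1E _] [r v w s] ATA.
have {}ATA x : P ((Mat2 r v w s : mc_ring T) * x * Mat2 r v w s).
  by apply: ATA; exists x.
split=> /=.
- apply: spI => _ [x _ <-].
  by have := ATA (Mat2 x 0 0 0); rewrite !mc_mulE !simp0 => -[].
- rewrite V1E => _ [w0 _ <-]; apply: spI => _ [x _ <-].
  have := ATA (Mat2 0 0 (w0 :*r x) 0); rewrite !mc_mulE !simp0 => -[_ /= + _ _].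
  by move=> /(mc_ideal_vwl w0); rewrite mc_vw_scalel mc_vw_rscaler.
- rewrite W1E => _ [v0 _ <-]; apply: spI => _ [x _ <-].
  (* The lower left corner is (w(x v0))w. Multiplying it by [v0] on the left gives (v0 w)x(v0 w),
     the sandwich needed in [I]. *)
  have := ATA (Mat2 0 (x *: v0) 0 0); rewrite !mc_mulE !simp0 => -[_ _ /= + _].
  move=> /(mc_ideal_vwr v0).
  by rewrite -mc_vw_rscalel mc_rscale_wv mc_vw_scalel mc_vw_scalel mulrA.
- apply: spJ => _ [y _ <-].
  by have := ATA (Mat2 0 0 0 y); rewrite !mc_mulE !simp0 => -[].
Qed.

Lemma absorbs_sandwich_mcP :
  absorbs_sandwich P <->
  [/\ absorbs_sandwich I, absorbs_sandwich J & annihilator_corners].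
Proof.
split=> [spP|[]]; last exact: absorbs_sandwich_mc.
split; [exact: absorbs_sandwich_ul|exact: absorbs_sandwich_dr|].
exact: absorbs_sandwich_corners.
Qed.

(** When [I] is all of [R], the conditions vW <= I and Vw <= I are vacuous, so [V1] and [W1] are
    everything too. *)
Lemma mc_set_eqT : annihilator_corners ->
  P = setT <-> I = setT /\ J = setT.
Proof.
case=> [V1E _ W1E _]; split=> [PT|[IT JT]].
  split; apply/seteqP; split=> // a _.
    by apply/mc_ideal_ulP; rewrite PT.
  by apply/mc_ideal_drP; rewrite PT.
apply/seteqP; split=> // -[r v w s] _.
by split=> /=; rewrite ?V1E ?W1E ?IT ?JT.
Qed.

End IdealComponents.

(** The whole ring absorbs sandwiches trivially; the converse decides classically whether [Q] is the
    whole ring. *)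
Lemma semiprime_or_improperP (A : nzRingType) (Q : set A) :
  two_sided_ideal Q -> semiprime_or_improper Q <-> absorbs_sandwich Q.
Proof.
move=> idQ; split=> [[[]|->]|spQ] //.
by have [?|?] := pselect (Q = setT); [right|left].
Qed.

Theorem theorem2p11 (R S : nzRingType) (V : bimodType R S) (W : bimodType S R)
    (T : moritaContext V W)
    (I : set R) (V1 : set V) (W1 : set W) (J : set S)
    (idealP : two_sided_ideal (mc_set T I V1 W1 J)) :
  ((I = setT <-> J = setT) ->
   (semiprime_ideal (mc_set T I V1 W1 J) <->
    [/\ semiprime_ideal I, semiprime_ideal J,
        V1 = [set v : V | [set mc_vw T v w | w in setT] `<=` I] /\
        V1 = [set v : V | [set mc_wv T w v | w in setT] `<=` J] &
        W1 = [set w : W | [set mc_vw T v w | v in setT] `<=` I] /\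
        W1 = [set w : W | [set mc_wv T w v | v in setT] `<=` J]]))
  /\
  (semiprime_or_improper (mc_set T I V1 W1 J) <->
   [/\ semiprime_or_improper I, semiprime_or_improper J,
       V1 = [set v : V | [set mc_vw T v w | w in setT] `<=` I] /\
       V1 = [set v : V | [set mc_wv T w v | w in setT] `<=` J] &
       W1 = [set w : W | [set mc_vw T v w | v in setT] `<=` I] /\
       W1 = [set w : W | [set mc_wv T w v | v in setT] `<=` J]]).
Proof.
have idI := mc_ideal_ul idealP; have idJ := mc_ideal_dr idealP.
have spP := absorbs_sandwich_mcP idealP.
have PT := mc_set_eqT idealP.
split=> [IJ|].
- split=> [[_ PnT /spP[spI spJ cor]]|[[_ InT spI] [_ _ spJ] [? ?] [? ?]]].
    have [V1E V1E' W1E W1E'] := cor.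
    (* If one diagonal corner were the whole ring, [IJ] would make the other one whole as well, and
       then [PT] would contradict the properness of the ideal. *)
    by split; split=> // QT; apply/PnT/PT => //; split=> //; exact/IJ.
  have cor : annihilator_corners T I V1 W1 J by [].
  by split=> //; [move/(PT cor) => -[]|apply/spP].
- rewrite (propext (semiprime_or_improperP idealP)).
  rewrite (propext (semiprime_or_improperP idI)).
  rewrite (propext (semiprime_or_improperP idJ)).
  by rewrite (propext spP); split=> [[? ? []]|[? ? [? ?] [? ?]]].
Qed.
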